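(* There is a complete (regular) subalgebra of the Cohen algebra $\mathbb C(\aleph_2)$ which has uniform density $\aleph_2$ but is not isomorphic to $\mathbb C(\aleph_2)$.
   Context: For a set $I$ of ordinals, $C(I)$ is the poset of finite partial functions from $I$ to $\{0,1\}$ ordered by reverse extension and $\mathbb C(I)=RO(C(I))$ its regular open algebra. A subalgebra $A$ of a complete Boolean algebra $B$ is complete (regular) if every maximal antichain of $A$ is maximal in $B$. A complete Boolean algebra $B$ has uniform density $\kappa$ if for every nonzero $b\in B$ the least cardinality of a dense subset of $\{c\in B:0<c\le b\}$ is $\kappa$. *)

(* Defs.v *)
From Stdlib Require List.
From mathcomp Require Import all_boot.
From mathcomp Require Import boolp classical_sets functions cardinality.
Set Implicit Arguments. Unset Strict Implicit. Unset Printing Implicit Defensive.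
Local Open Scope classical_set_scope.
Local Open Scope card_scope.

Definition wellorder_on {U : Type} (X : set U) (lt : U -> U -> Prop) : Prop :=
  (forall x, X x -> ~ lt x x) /\
  (forall x y z, X x -> X y -> X z -> lt x y -> lt y z -> lt x z) /\
  (forall x y, X x -> X y -> x = y \/ lt x y \/ lt y x) /\
  (forall S, S `<=` X -> S !=set0 -> exists2 m, S m & forall y, S y -> ~ lt y m).

Definition init_seg {U : Type} (X : set U) (lt : U -> U -> Prop) (x : U) : set U :=
  [set y | X y /\ lt y x].

Definition card_le_aleph1 {U : Type} (X : set U) : Prop :=
  exists lt, wellorder_on X lt /\ forall x, X x -> countable (init_seg X lt x).

Definition card_is_aleph2 {U : Type} (X : set U) : Prop :=
  ~ card_le_aleph1 X /\
  exists lt, wellorder_on X lt /\ forall x, X x -> card_le_aleph1 (init_seg X lt x).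

Definition Cond (I : Type) : Type :=
  {p : I -> option bool | exists s : seq I, forall i, p i <> None -> List.In i s}.

Definition cle {I : Type} (q p : Cond I) : Prop :=
  forall i b, proj1_sig p i = Some b -> proj1_sig q i = Some b.

(* U is regular open in the downward topology: p in U iff every q <= p has
   some r <= q in U (this implies U is downward closed) *)
Definition regular_open {I : Type} (U : set (Cond I)) : Prop :=
  forall p, U p <-> (forall q, cle q p -> exists2 r, cle r q & U r).

(* the carrier of the Cohen algebra \mathbb C(I) = RO(C(I)), ordered by inclusion *)
Definition RO (I : Type) : set (set (Cond I)) := [set U | regular_open U].

Definition ro_compl {I : Type} (U : set (Cond I)) : set (Cond I) :=
  [set p | forall q, cle q p -> ~ U q].

Definition ro_subalgebra {I : Type} (A : set (set (Cond I))) : Prop :=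
  A `<=` @RO I /\ A set0 /\ A setT /\
  (forall a b, A a -> A b -> A (a `&` b)) /\
  (forall a, A a -> A (ro_compl a)).

Definition antichain_in {I : Type} (X : set (set (Cond I))) (W : set (set (Cond I))) : Prop :=
  W `<=` X /\ (forall w, W w -> w <> set0) /\
  (forall w v, W w -> W v -> w <> v -> w `&` v = set0).

Definition maximal_antichain_in {I : Type} (X : set (set (Cond I))) (W : set (set (Cond I))) : Prop :=
  antichain_in X W /\
  ~ (exists2 a, X a & a <> set0 /\ forall w, W w -> a `&` w = set0).

Definition complete_in {I : Type} (A : set (set (Cond I))) : Prop :=
  forall S, S `<=` A -> exists s, A s /\ (forall x, S x -> x `<=` s) /\
     (forall t, A t -> (forall x, S x -> x `<=` t) -> s `<=` t).

Definition complete_subalgebra {I : Type} (A : set (set (Cond I))) : Prop :=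
  ro_subalgebra A /\ complete_in A /\
  (forall W, maximal_antichain_in A W -> maximal_antichain_in (@RO I) W).

Definition dense_below {I : Type} (A : set (set (Cond I))) (b : set (Cond I))
    (D : set (set (Cond I))) : Prop :=
  (forall d, D d -> A d /\ d <> set0 /\ d `<=` b) /\
  (forall c, A c -> c <> set0 -> c `<=` b -> exists2 d, D d & d `<=` c).

Definition uniform_density_aleph2 {I : Type} (A : set (set (Cond I))) : Prop :=
  forall b, A b -> b <> set0 ->
    (exists D, dense_below A b D /\ card_is_aleph2 D) /\
    (forall D, dense_below A b D -> ~ card_le_aleph1 D).

(* Isomorphism of Boolean algebras = order isomorphism (w.r.t. inclusion) *)
Definition ba_isomorphic {I J : Type} (A : set (set (Cond I))) (B : set (set (Cond J))) : Prop :=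
  exists f : set (Cond I) -> set (Cond J),
    set_bij A B f /\ forall x y, A x -> A y -> (x `<=` y <-> f x `<=` f y).

(* Main.v *)
Require Import Defs.
From mathcomp Require Import all_boot.
From mathcomp Require Import boolp classical_sets functions cardinality.
Set Implicit Arguments. Unset Strict Implicit. Unset Printing Implicit Defensive.
Local Open Scope classical_set_scope.

(** The subalgebra is generated by a family of partial functions f_a from nat to
    bool, a ranging over a set L of size aleph_2, each of which is, up to finitely
    many values, the restriction to a Cohen subset of nat of one Cohen real C.
    Only the f_a are visible, neither C nor the place from which f_a follows C;
    so any two f_a agree almost everywhere on their common domain.

    If the subalgebra were Cohen, a closing-off argument would give, for a : L, a
    countable set M(a) such that the subalgebras F(M(a)) and C(M(a)) generated by
    the f_c and by the Cohen bits indexed by M(a) coincide. As L has size aleph_2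
    there are a, b with b not in M(a) and a not in M(b). Then f_a and f_b live in
    C(M(a)) and C(M(b)), hence are mutually generic over C(M(a) cap M(b)), which is
    F(M(a) cap M(b)). But from the visible information in M(a) cap M(b) nothing
    prevents f_a and f_b from disagreeing at arbitrarily large common points, and
    genericity would make them do so. *)

(** * Cardinalities *)

Lemma countable_lists {A : Type} (C : set A) :
  countable C -> countable [set l : seq A | forall x, List.In x l -> C x].
Proof.
move=> /countable_injP[f finj]; apply/countable_injP.
exists (fun l => pickle (map f l)) => l l'; rewrite !inE => lC l'C.
move=> /(pcan_inj pickleK); elim: l l' lC l'C => [|x l IH] [|y l'] //= lC l'C.
case=> exy ell'; congr (_ :: _).
  by apply: finj exy; rewrite inE; [apply: lC|apply: l'C]; left.
by apply: IH ell' => z zl; [apply: lC|apply: l'C]; right.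
Qed.

Lemma countable_surj {A B : Type} (C : set A) (D : set B) (f : A -> B) :
  countable C -> D `<=` f @` C -> countable D.
Proof.
move=> cC DC; apply: (sub_countable _ cC).
exact: card_le_trans (subset_card_le DC) (card_image_le _ _).
Qed.

Lemma countable_inj {A B : Type} (C : set A) (D : set B) (f : A -> B) :
  countable D -> (forall x, C x -> D (f x)) ->
  (forall x y, C x -> C y -> f x = f y -> x = y) -> countable C.
Proof.
move=> /countable_injP[g ginj] CD finj; apply/countable_injP; exists (g \o f).
move=> x y; rewrite !inE => Cx Cy /= /ginj; rewrite !inE => gg.
by apply: finj => //; apply: gg; apply: CD.
Qed.

Lemma countable_setU {A : Type} (C D : set A) :
  countable C -> countable D -> countable (C `|` D).
Proof. by move=> cC cD; rewrite -bigcup2E; apply: bigcup_countable => // -[|[|i]]. Qed.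

(** Closed segments are used so that every finite subset of a nonempty [Y] lies in one of them, even
    if [Y] has a greatest element. *)
Definition closed_seg {A : Type} (Y : set A) (lt : A -> A -> Prop) (y : A) : set A :=
  [set z | Y z /\ (z = y \/ lt z y)].

(** The typical [F C] consists of the objects with finite support in [C]. Then [F Y] is the union of
    its values at the closed segments of [Y], and this replaces cardinal arithmetic in bounding its
    size. *)
Definition finitary {A B : Type} (F : set A -> set B) : Prop :=
  (forall C D, C `<=` D -> F C `<=` F D) /\
  (forall C b, F C b -> exists s : seq A,
     (forall x, List.In x s -> C x) /\ F [set x | List.In x s] b).

Lemma countable_wellorder {A : Type} (X : set A) :
  countable X -> exists lt, wellorder_on X lt.
Proof.
move=> /countable_injP[f finj].
have inj x y : X x -> X y -> f x = f y -> x = y.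
  by move=> Xx Xy; apply: finj; rewrite inE.
exists (fun x y => f x < f y); split; first by move=> x _; rewrite ltnn.
split; first by move=> x y z _ _ _; apply: ltn_trans.
split.
  move=> x y Xx Xy; case: (ltngtP (f x) (f y)) => [||e]; first by right; left.
    by right; right.
  by left; apply: inj.
move=> S SX [x Sx].
have ex : exists n, `[< exists2 y, S y & f y = n >].
  by exists (f x); apply/asboolP; exists x.
case: (ex_minnP ex) => n /asboolP[y Sy <-] ymin; exists y => // z Sz.
by apply/negP; rewrite -leqNgt; apply: ymin; apply/asboolP; exists z.
Qed.

Lemma countable_le_aleph1 {A : Type} (X : set A) : countable X -> card_le_aleph1 X.
Proof.
move=> cX; have [lt wlt] := countable_wellorder cX; exists lt; split=> // x _.
by apply: sub_countable cX; apply: subset_card_le => y [].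
Qed.

Lemma wellorder_bound {A : Type} (Y : set A) lt (s : seq A) :
  wellorder_on Y lt -> Y !=set0 -> (forall x, List.In x s -> Y x) ->
  exists2 y, Y y & forall x, List.In x s -> closed_seg Y lt y x.
Proof.
move=> [irr [tr [tot _]]] [y0 Y0]; elim: s => [|a s IH] sY; first by exists y0.
have [y Yy ys] : exists2 y, Y y & forall x, List.In x s -> closed_seg Y lt y x.
  by apply: IH => x xs; apply: sY; right.
have Ya : Y a by apply: sY; left.
case: (tot a y Ya Yy) => [ay|[ay|ya]].
- by exists y => // x [<-|/ys//]; split=> //; left.
- by exists y => // x [<-|/ys//]; split=> //; right.
- exists a => // x [<-|/ys[Yx xy]]; first by split=> //; left.
  split=> //; right; case: xy => [->//|xy]; exact: tr xy ya.
Qed.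

(* Ordering the union of an increasing chain F(seg y) first by the least stage y
   and then inside that stage. *)
Lemma finitary_wellorder {A B : Type} (F : set A -> set B) (Y : set A) lt :
  finitary F -> wellorder_on Y lt -> Y !=set0 ->
  (forall y, Y y -> exists lt', wellorder_on (F (closed_seg Y lt y)) lt') ->
  exists lt', wellorder_on (F Y) lt' /\
    forall b, F Y b -> exists2 y, Y y & init_seg (F Y) lt' b `<=` F (closed_seg Y lt y).
Proof.
move=> [Fmono Ffin] wY Y0 FY; have [irr [tr [tot wf]]] := wY.
have [lt' wlt'] : {lt' : A -> B -> B -> Prop &
    forall y, Y y -> wellorder_on (F (closed_seg Y lt y)) (lt' y)}.
  apply: (choice (P := fun y l => Y y -> wellorder_on (F (closed_seg Y lt y)) l)) => y.
  have [Yy|nYy] := pselect (Y y); last by exists (fun _ _ => False).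
  by have [l wl] := FY y Yy; exists l.
have segmono y z : Y y -> Y z -> lt y z ->
    closed_seg Y lt y `<=` closed_seg Y lt z.
  move=> Yy Yz yz x [Yx [->|xy]]; split=> //; right => //; exact: tr xy yz.
have [st stP] : {st : B -> A & forall b, F Y b ->
    [/\ Y (st b), F (closed_seg Y lt (st b)) b &
      forall z, Y z -> F (closed_seg Y lt z) b -> ~ lt z (st b)]}.
  apply: (choice (P := fun b y => F Y b -> [/\ Y y, F (closed_seg Y lt y) b &
      forall z, Y z -> F (closed_seg Y lt z) b -> ~ lt z y])) => b.
  have [Fb|nFb] := pselect (F Y b); last by have [y] := Y0; exists y.
  have [s [sY Fs]] := Ffin _ _ Fb.
  have [y Yy ys] := wellorder_bound wY Y0 sY.
  have [||m [Ym Fm] mmin] := wf [set z | Y z /\ F (closed_seg Y lt z) b].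
  - by move=> z [].
  - by exists y; split=> //; apply: Fmono Fs.
  - by exists m => _; split=> // z Yz Fz; apply: mmin.
exists (fun b c => lt (st b) (st c) \/ st b = st c /\ lt' (st b) b c); split; last first.
  move=> b Fb; have [Yb Fsb _] := stP _ Fb; exists (st b) => // c [Fc H].
  have [Yc Fsc _] := stP _ Fc; case: H => [cb|[e _]]; last by rewrite -e.
  by apply: Fmono Fsc; apply: segmono.
split.
  move=> b Fb; have [Yb Fsb _] := stP _ Fb; case=> [|[_]]; first exact: irr.
  by have [i _] := wlt' _ Yb; apply: i.
split.
  move=> b c d Fb Fc Fd; have [Yb Fsb _] := stP _ Fb; have [Yc Fsc _] := stP _ Fc.
  have [Yd Fsd _] := stP _ Fd.
  case=> [bc|[ebc bc]]; case=> [cd|[ecd cd]].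
  - by left; apply: tr bc cd.
  - by left; rewrite -ecd.
  - by left; rewrite ebc.
  - right; split; first by rewrite ebc.
    have [_ [t _]] := wlt' _ Yb; apply: (t b c d) => //; try by rewrite ebc.
    by rewrite ebc ecd.
split.
  move=> b c Fb Fc; have [Yb Fsb _] := stP _ Fb; have [Yc Fsc _] := stP _ Fc.
  case: (tot _ _ Yb Yc) => [e|[?|?]]; last 2 first.
  - by right; left; left.
  - by right; right; left.
  have [_ [_ [t _]]] := wlt' _ Yb; rewrite -e in Fsc.
  case: (t b c Fsb Fsc) => [?|[?|?]]; first by left.
  - by right; left; right.
  - by right; right; right; rewrite -e.
move=> S SF [b0 Sb0].
have [||m [b Sb ebm] mmin] := wf (st @` S).
- by move=> _ [b Sb <-]; have [] := stP _ (SF _ Sb).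
- by exists (st b0); exists b0.
have [Yb Fsb _] := stP _ (SF _ Sb); rewrite ebm in Yb Fsb.
have [_ [_ [_ w]]] := wlt' _ Yb.
have [||c [Sc ec] cmin] := w [set c | S c /\ st c = m].
- by move=> c [Sc <-]; have [] := stP _ (SF _ Sc).
- by exists b.
- exists c => // d Sd [dc|[ed dc]]; first by apply: (mmin (st d)); [exists d|rewrite -ec].
  by apply: (cmin d); [split; rewrite // ed|rewrite -ec -ed].
Qed.

Lemma finitary_set0 {A B : Type} (F : set A -> set B) (Y : set A) :
  finitary F -> ~ (Y !=set0) -> F Y = F set0.
Proof. by move=> [Fm _] Y0; congr (F _); rewrite predeqE => x; split=> // Yx; case: Y0; exists x. Qed.

(** Each stage [F (closed_seg Y lt y)] is countable, and every initial segment of the order given by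
    [finitary_wellorder] lies inside one stage. *)
Lemma finitary_le_aleph1 {A B : Type} (F : set A -> set B) (Y : set A) :
  finitary F -> (forall C, countable C -> countable (F C)) ->
  card_le_aleph1 Y -> card_le_aleph1 (F Y).
Proof.
move=> fF cF [lt [wY segY]].
have [Y0|Y0] := pselect (Y !=set0); last first.
  by apply: countable_le_aleph1; rewrite finitary_set0//; apply: cF; exact: countable0.
have cF' y : Y y -> countable (F (closed_seg Y lt y)).
  move=> Yy; apply: cF.
  suff -> : closed_seg Y lt y = y |` init_seg Y lt y.
    by apply: countable_setU; [exact: countable1|exact: segY].
  rewrite predeqE => z; split.
    by case=> Yz [->|?]; [left|right].
  by case=> [->|[Yz ?]]; split=> //; [left|right].
have [y Yy|lt' [wlt' lt'P]] := finitary_wellorder fF wY Y0.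
  exact: countable_wellorder (cF' y Yy).
exists lt'; split=> // b Fb; have [y Yy sy] := lt'P b Fb.
exact: sub_countable (subset_card_le sy) (cF' y Yy).
Qed.

Lemma le_aleph1_setU1 {A : Type} (X : set A) x :
  card_le_aleph1 X -> card_le_aleph1 (x |` X).
Proof.
apply: (@finitary_le_aleph1 _ _ (fun C => x |` C)); last first.
  by move=> C cC; apply: countable_setU => //; exact: countable1.
split; first by move=> C D CD y [?|/CD ?]; [left|right].
move=> C b [->|Cb]; first by exists [::]; split=> //; left.
by exists [:: b]; split=> [y [<-|]//|]; right; left.
Qed.

Lemma le_aleph1_bigcup {A B : Type} (X : set A) (M : A -> set B) :
  card_le_aleph1 X -> (forall x, countable (M x)) ->
  card_le_aleph1 (\bigcup_(x in X) M x).
Proof.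
move=> lX cM; apply: (@finitary_le_aleph1 _ _ (fun C => \bigcup_(x in C) M x)) lX.
  split=> [C D CD b [x Cx Mb]|C b [x Cx Mb]]; first by exists x => //; apply: CD.
  by exists [:: x]; split=> [y [<-|]//|]; exists x => //; left.
by move=> C cC; apply: bigcup_countable.
Qed.

Lemma le_aleph1_sub {A : Type} (X Y : set A) :
  X `<=` Y -> card_le_aleph1 Y -> card_le_aleph1 X.
Proof.
move=> XY lY; have -> : X = [set x | Y x /\ X x].
  by rewrite predeqE => x; split=> [Xx|[]//]; split=> //; apply: XY.
apply: (@finitary_le_aleph1 _ _ (fun C => [set x | C x /\ X x])) lY.
  split=> [C D CD b [/CD ? ?]//|C b [Cb Xb]].
  by exists [:: b]; split=> [y [<-|]//|]; split=> //; left.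
move=> C cC; apply: sub_countable cC; apply: subset_card_le; by move=> x [].
Qed.

(** The chain argument of [finitary_le_aleph1], one cardinal higher: now the stages have size at
    most aleph_1. *)
Lemma finitary_wellorder_aleph2 {A B : Type} (F : set A -> set B) (Y : set A) lt :
  finitary F -> (forall C, countable C -> countable (F C)) ->
  wellorder_on Y lt -> (forall y, Y y -> card_le_aleph1 (init_seg Y lt y)) ->
  exists lt', wellorder_on (F Y) lt' /\
    forall b, F Y b -> card_le_aleph1 (init_seg (F Y) lt' b).
Proof.
move=> fF cF wY segY.
have [Y0|Y0] := pselect (Y !=set0); last first.
  have cFY : countable (F Y) by rewrite finitary_set0//; apply: cF; exact: countable0.
  have [lt' wlt'] := countable_wellorder cFY; exists lt'; split=> // b _.
  apply: countable_le_aleph1; apply: sub_countable cFY; apply: subset_card_le.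
  by move=> c [].
have lF y : Y y -> card_le_aleph1 (F (closed_seg Y lt y)).
  move=> Yy; apply: finitary_le_aleph1 => //.
  apply: (@le_aleph1_sub _ _ (y |` init_seg Y lt y)).
    by move=> z [Yz [->|?]]; [left|right].
  exact: le_aleph1_setU1 (segY y Yy).
have [y /lF[l [wl _]]|lt' [wlt' lt'P]] := finitary_wellorder fF wY Y0.
  by exists l.
exists lt'; split=> // b Fb; have [y Yy sy] := lt'P b Fb.
exact: le_aleph1_sub sy (lF y Yy).
Qed.

(** [Y] is the copy of omega_1 formed by the points with countably many predecessors. Were it
    countable, the least point outside [Y] would have all its predecessors in [Y], hence belong to
    [Y]. *)
Lemma uncountable_le_aleph1 {A : Type} :
  card_is_aleph2 [set: A] -> exists Y : set A, card_le_aleph1 Y /\ ~ countable Y.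
Proof.
move=> [nA [lt [wA segA]]]; have [irr [tr [tot wf]]] := wA.
pose Y := [set x | countable (init_seg setT lt x)].
exists Y; split.
  exists lt; split.
    split; first by move=> x _; apply: irr.
    split; first by move=> x y z _ _ _; apply: tr.
    split; first by move=> x y _ _; apply: tot.
    by move=> S _; apply: wf.
  by move=> x; apply: sub_countable; apply: subset_card_le => y [].
move=> cY; apply: nA.
have [[m nYm mmin]|nex] := pselect (exists2 m, ~ Y m & forall y, ~ Y y -> ~ lt y m).
  case: nYm; apply: sub_countable cY; apply: subset_card_le => y [_ ym].
  by apply: contrapT => /mmin.
apply: countable_le_aleph1; apply: sub_countable cY; apply: subset_card_le => y _.
apply: contrapT => nYy; apply: nex.
by have [|m nYm mmin] := wf [set y | ~ Y y] (fun _ _ => I); [exists y|exists m].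
Qed.

(* With Y of size aleph_1, some b avoids all M a for a in Y, and the countable
   set M b misses some a in Y. *)
Lemma free_pair {A : Type} (M : A -> set A) :
  card_is_aleph2 [set: A] -> (forall a, countable (M a)) ->
  exists a b, ~ M a b /\ ~ M b a.
Proof.
move=> hA cM; have [Y [lY ncY]] := uncountable_le_aleph1 hA.
have [nA _] := hA.
have [b nb] : exists b, ~ (\bigcup_(a in Y) M a) b.
  apply: contrapT => nex; apply: nA; apply: le_aleph1_sub (le_aleph1_bigcup lY cM).
  by move=> b _; apply: contrapT => nb; apply: nex; exists b.
have [a [Ya nab]] : exists a, Y a /\ ~ M b a.
  apply: contrapT => nex; apply: ncY; apply: sub_countable (cM b).
  apply: subset_card_le => a Ya; apply: contrapT => na; apply: nex; by exists a.
by exists a, b; split=> // Mab; apply: nb; exists a.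
Qed.

Lemma sval_inj {A : Type} {P : A -> Prop} (x y : {a | P a}) : sval x = sval y -> x = y.
Proof. by case: x y => x p [y q] /= e; exact: eq_exist. Qed.

(* Every ordinal is uniquely lambda + n with lambda not a successor, which gives
   a copy of L x nat inside T without cardinal multiplication. *)
Lemma aleph2_times_nat {T : Type} :
  card_is_aleph2 [set: T] -> exists L : eqType, card_is_aleph2 [set: L] /\
  exists i : L -> nat -> T, forall a b k l, i a k = i b l -> a = b /\ k = l.
Proof.
move=> [nT [lt [wT segT]]]; have [irr' [tr' [tot' wf]]] := wT.
have irr x : ~ lt x x by apply: irr'.
have tr x y z : lt x y -> lt y z -> lt x z by apply: tr'.
have tot x y : x = y \/ lt x y \/ lt y x by apply: tot'.
have [sc scP] : {sc : T -> T & forall t, lt t (sc t) /\ forall u, lt t u -> ~ lt u (sc t)}.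
  apply: (choice (P := fun t s => lt t s /\ forall u, lt t u -> ~ lt u s)) => t.
  have [|nex] := pselect ([set u | lt t u] !=set0).
    by case/(wf _ (fun _ _ => I)) => m tm mmin; exists m.
  (* A greatest element [t] would make the whole set an initial segment plus one point, of size at
     most aleph_1. *)
  case: nT; apply: le_aleph1_sub (le_aleph1_setU1 t (segT t I)) => u _.
  case: (tot u t) => [->|[ut|tu]]; [by left|by right|].
  by case: nex; exists u.
have scinj t u : sc t = sc u -> t = u.
  have [t1 t2] := scP t; have [u1 u2] := scP u => e.
  by case: (tot t u) => [//|[/t2|/u2]]; rewrite ?e // -e.
(* The least element satisfies [lim] vacuously. *)
pose lim t := forall s, lt s t -> exists2 u, lt s u & lt u t.
have sc_nlim t : ~ lim (sc t).
  by move=> /(_ t (scP t).1)[u /((scP t).2)].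
pose L := {t : T | lim t}.
pose i (a : L) k := iter k sc (sval a).
have iinj (a b : L) k l : i a k = i b l -> a = b /\ k = l.
  elim: k l => [|k IH] [|l] //=.
  - by move=> e; split=> //; exact: sval_inj.
  - move=> e; case: (sc_nlim (i b l)); rewrite /i -e; exact: svalP.
  - move=> e; case: (sc_nlim (i a k)); rewrite /i e; exact: svalP.
  - by move=> /scinj /IH[-> ->].
(* A least counterexample is either a limit, reached with [k = 0], or the successor of an element
   already reached. *)
have isurj t : exists a k, i a k = t.
  apply: contrapT => nex.
  have [|m nm mmin] := wf [set t | ~ exists a k, i a k = t] (fun _ _ => I).
    by exists t.
  have [lm|] := pselect (lim m); first by apply: nm; exists (exist _ m lm), 0.
  move=> /existsNP[s /not_implyP[sm nu]].
  have es : sc s = m.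
    have [s1 s2] := scP s; case: (tot (sc s) m) => [//|[h|/(s2 _ sm)//]].
    by case: nu; exists (sc s).
  have [a [k ik]] : exists a k, i a k = s by apply: contrapT => /mmin.
  by apply: nm; exists a, k.+1; rewrite /i /= -es -ik.
have finL : finitary (fun C : set L => [set t | exists2 a, C a & exists k, i a k = t]).
  split=> [C D CD t [a Ca ak]|C t [a Ca ak]]; first by exists a => //; apply: CD.
  by exists [:: a]; split=> [b [<-|]//|]; exists a => //; left.
have finT : finitary (fun C : set T => [set a : L | C (sval a)]).
  split=> [C D CD a /CD//|C a Ca].
  by exists [:: sval a]; split=> [b [<-|]//|]; left.
(* [classic] supplies the decidable equality that later lists over [L] rely on. *)
exists {classic L}; split; last by exists i.
split.
  move=> lL; apply: nT.
  suff -> : [set: T] = [set t | exists2 a, [set: L] a & exists k, i a k = t].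
    apply: (finitary_le_aleph1 finL) lL => C cC.
    apply: (@countable_surj _ _ (C `*` [set: nat]) _ (fun x => i x.1 x.2)).
      by apply: countableX.
    by move=> t [a Ca [k <-]]; exists (a, k).
  by rewrite predeqE => t; split=> // _; have [a [k]] := isurj t; exists a => //; exists k.
exists (fun a b : L => lt (sval a) (sval b)); split.
  split; first by move=> x _; apply: irr.
  split; first by move=> x y z _ _ _; apply: tr.
  split.
    move=> x y _ _; case: (tot (sval x) (sval y)) => [?|]; last by right.
    by left; exact: sval_inj.
  move=> S _ [a Sa]; have [|m [b Sb <-] mmin] := wf (sval @` S) (fun _ _ => I).
    by exists (sval a); exists a.
  by exists b => // c Sc; apply: mmin; exists c.
move=> a _; have := finitary_le_aleph1 finT _ (segT (sval a) I).
suff -> : [set a0 | init_seg [set: T] lt (sval a) (sval a0)] =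
    init_seg [set: L] (fun a b : L => lt (sval a) (sval b)) a.
  apply=> C cC; apply: countable_inj cC _ _; first by move=> x; apply.
  by move=> x y _ _ e; exact: sval_inj.
by rewrite predeqE => b; split=> -[].
Qed.

(** * Subalgebras invariant under a bisimulation *)

Lemma cle_refl {I : Type} (p : Cond I) : cle p p. Proof. by []. Qed.

Lemma cle_trans {I : Type} (p q r : Cond I) : cle p q -> cle q r -> cle p r.
Proof. by move=> pq qr i b /qr /pq. Qed.

Lemma regular_open_cle {I : Type} (U : set (Cond I)) p q :
  regular_open U -> cle q p -> U p -> U q.
Proof.
by move=> rU qp /rU Up; apply/rU => r rq; apply: Up; exact: cle_trans rq qp.
Qed.

Lemma regular_openI {I : Type} (U V : set (Cond I)) :
  regular_open U -> regular_open V -> regular_open (U `&` V).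
Proof.
move=> rU rV p; split=> [[Up Vp] q qp|H].
  by exists q => //; split; apply: (regular_open_cle _ qp).
split; [apply/rU|apply/rV] => q /H[r rq [Ur Vr]]; by exists r.
Qed.

Lemma regular_open0 {I : Type} : regular_open (@set0 (Cond I)).
Proof. by move=> p; split=> // /(_ p (@cle_refl _ p)) []. Qed.

Lemma regular_openT {I : Type} : regular_open [set: Cond I].
Proof. by move=> p; split=> // _ q _; exists q. Qed.

Lemma regular_open_compl {I : Type} (U : set (Cond I)) :
  regular_open U -> regular_open (ro_compl U).
Proof.
move=> rU p; split=> [Up q qp|H q qp Uq].
  by exists q => // r rq; apply: Up; exact: cle_trans rq qp.
have [r rq /(_ r (@cle_refl _ r))] := H q qp; apply.
exact: regular_open_cle rq Uq.
Qed.

(** By [sub_hull] and [hull_sub] this is the least regular open set containing [U]: the downward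
    closure of [U] is dense below its members. Suprema in the Cohen algebra are hulls of unions. *)
Definition ro_hull {I : Type} (U : set (Cond I)) : set (Cond I) :=
  [set p | forall q, cle q p -> exists2 r, cle r q & exists2 s, U s & cle r s].

Lemma regular_open_hull {I : Type} (U : set (Cond I)) : regular_open (ro_hull U).
Proof.
move=> p; split=> [Up q qp|H q qp].
  by exists q => // r rq; apply: Up; exact: cle_trans rq qp.
have [r rq Ur] := H q qp; have [s sr Us] := Ur r (@cle_refl _ r).
by exists s => //; exact: cle_trans sr rq.
Qed.

Lemma sub_hull {I : Type} (U : set (Cond I)) : U `<=` ro_hull U.
Proof. by move=> p Up q qp; exists q => //; exists p. Qed.

Lemma hull_sub {I : Type} (U V : set (Cond I)) :
  regular_open V -> U `<=` V -> ro_hull U `<=` V.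
Proof.
move=> rV UV p Up; apply/rV => q /Up[r rq [s /UV Vs rs]]; exists r => //.
exact: regular_open_cle rs Vs.
Qed.

Definition below {I : Type} (c : Cond I) : set (Cond I) := [set p | cle p c].

Lemma cond_of_fun {I : Type} (f : I -> option bool) (s : seq I) :
  (forall i, f i <> None -> List.In i s) -> exists c : Cond I, sval c = f.
Proof.
move=> fs; have fP : exists s, forall i, f i <> None -> List.In i s by exists s.
by exists (exist _ f fP).
Qed.

(** Separativity of Cohen forcing: at a coordinate where [p] fails to follow [c], either [p] already
    has the opposite bit or it can be given that bit. *)
Lemma not_cle_incompatible {I : Type} (p c : Cond I) : ~ cle p c ->
  exists2 q, cle q p & forall r, cle r q -> ~ cle r c.
Proof.
move=> /existsNP[i /existsNP[b /not_implyP[ci pi]]].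
have [s sP] := svalP p.
pose f j := if pselect (j = i) then Some (~~ b) else sval p j.
have [q qf] : exists q : Cond I, sval q = f.
  apply: (@cond_of_fun _ f (i :: s)) => j; rewrite /f.
  by case: pselect => [ji _|_ /sP]; [left|right].
case epi : (sval p i) => [b'|].
  exists p => // r rp rc; have := rc i b ci; rewrite (rp i b' epi) => -[e].
  by apply: pi; rewrite epi e.
exists q.
  move=> j b' pj; rewrite qf /f; case: pselect => // e; by rewrite e epi in pj.
move=> r rq rc; have : sval r i = Some (~~ b).
  by apply: rq; rewrite qf /f; case: pselect.
by rewrite (rc i b ci) => -[]; case: (b).
Qed.

Lemma regular_open_below {I : Type} (c : Cond I) : regular_open (below c).
Proof.
move=> p; split=> [pc q qp|H]; first by exists q => //; exact: cle_trans qp pc.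
apply: contrapT => /not_cle_incompatible[q qp qn].
by have [r rq rc] := H q qp; exact: qn rq rc.
Qed.

(** Suprema of [A] are then computed as in the whole algebra. So a nonzero regular open set disjoint
    from [W] makes the complement of the hull of the union of [W] a nonzero element of [A] disjoint
    from [W]. *)
Lemma complete_subalgebra_of_hull {I : Type} (A : set (set (Cond I))) :
  ro_subalgebra A -> (forall S, S `<=` A -> A (ro_hull (\bigcup_(U in S) U))) ->
  complete_subalgebra A.
Proof.
move=> sA hA; have [Aro [A0 [AT [AI AC]]]] := sA; split=> //; split.
  move=> S SA; exists (ro_hull (\bigcup_(U in S) U)); split; first exact: hA.
  split=> [x Sx p xp|t At St]; first by apply: sub_hull; exists x.
  by apply: hull_sub; [exact: Aro|move=> p [x Sx xp]; exact: St xp].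
move=> W [[WA [Wn0 Wd]] Wmax]; split; first by split=> // w Ww; exact: Aro (WA _ Ww).
move=> [a roa [an0 aW]]; apply: Wmax.
exists (ro_compl (ro_hull (\bigcup_(U in W) U))); first exact/AC/hA.
split.
  have /set0P[p ap] : a != set0 by apply/eqP.
  move=> e; suff : set0 p by []; rewrite -e => q qp Hq.
  have [r rq [s [w Ww ws] rs]] := Hq q (@cle_refl _ q).
  suff : set0 r by []; rewrite -(aW w Ww); split.
    by apply: (regular_open_cle roa _ ap); exact: cle_trans rq qp.
  exact: regular_open_cle (Aro _ (WA _ Ww)) rs ws.
move=> w Ww; rewrite predeqE => p; split=> // -[np wp].
by case: (np p (@cle_refl _ p)); apply: sub_hull; exists w.
Qed.

(* [vis p q] says that q is exactly the information about p that is visible in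
   the subalgebra; by [vis_lift], having the same visible part is a bisimulation. *)
Record projection {T Q : Type} (le : Q -> Q -> Prop) (vis : Cond T -> Q -> Prop) : Prop := {
  proj_trans : forall q r s, le q r -> le r s -> le q s;
  vis_dense : forall p, exists2 p', cle p' p & exists q, vis p' q;
  vis_mono : forall p q p' q', vis p q -> vis p' q' -> cle p' p -> le q' q;
  vis_lift : forall p q q', vis p q -> le q' q -> exists2 p', cle p' p & vis p' q';
  vis_surj : forall q, exists p, vis p q }.

Section InvariantAlgebra.
Context {T Q : Type} (le : Q -> Q -> Prop) (vis : Cond T -> Q -> Prop).
Hypothesis H : projection le vis.

Definition invariant_sets : set (set (Cond T)) :=
  [set U | regular_open U /\ forall p p' q, vis p q -> vis p' q -> U p -> U p'].

(** One back-and-forth move: shrink [s] until it has a visible part, which is below [q] by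
    [vis_mono], and realize that part below [p] by [vis_lift]. *)
Lemma bisimilar p p' q s : vis p q -> vis p' q -> cle s p' ->
  exists s' r q', [/\ cle s' s, cle r p, vis s' q' & vis r q'].
Proof.
move=> pq p'q sp'; have [s' s's [q' s'q']] := vis_dense H s.
have [r rp rq'] := vis_lift H pq (vis_mono H p'q s'q' (cle_trans s's sp')).
by exists s', r, q'.
Qed.

Lemma invariant_complete : complete_subalgebra invariant_sets.
Proof.
apply: complete_subalgebra_of_hull; last first.
  move=> S SA; split; first exact: regular_open_hull.
  move=> p p' q pq p'q Sp s sp'.
  (* Two moves: the extension [s] of [p'] is matched below [p], a member of the union is found
     there, and it is carried back below [s]. *)
  have [s' [r [q' [s's rp s'q' rq']]]] := bisimilar pq p'q sp'.
  have [t tr [u [U SU Uu] tu]] := Sp r rp.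
  have [rU invU] := SA _ SU.
  have Ut : U t by exact: regular_open_cle tu Uu.
  have [t' [v [q'' [t't vs' t'q vq]]]] := bisimilar s'q' rq' tr.
  exists v; first exact: cle_trans vs' s's.
  exists v => //; exists U => //; apply: (invU t' v q'') => //.
  exact: regular_open_cle t't Ut.
split; first by move=> U [].
split; first by split=> //; exact: regular_open0.
split; first by split=> //; exact: regular_openT.
split.
  move=> U V [rU iU] [rV iV]; split; first exact: regular_openI.
  by move=> p p' q pq p'q [Up Vp]; split; [exact: iU pq p'q Up|exact: iV pq p'q Vp].
move=> U [rU iU]; split; first exact: regular_open_compl.
move=> p p' q pq p'q np s sp' Us.
have [s' [r [q' [s's rp s'q' rq']]]] := bisimilar pq p'q sp'.
apply: (np r rp); apply: (iU _ _ _ s'q' rq'); exact: regular_open_cle s's Us.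
Qed.

(** The Boolean value of the statement that the visible part of the generic object extends [q]. *)
Definition basic (q : Q) : set (Cond T) :=
  [set p | forall s, cle s p -> exists2 r, cle r s & exists2 q', le q' q & vis r q'].

Lemma basic_vis p q : vis p q -> basic q p.
Proof.
move=> pq s sp; have [r rs [q' rq']] := vis_dense H s; exists r => //.
by exists q' => //; apply: (vis_mono H pq rq'); exact: cle_trans rs sp.
Qed.

Lemma basic_neq0 q : basic q <> set0.
Proof.
have [p pq] := vis_surj H q => e; have := basic_vis pq; by rewrite e.
Qed.

Lemma basic_le q q' : le q' q -> basic q' `<=` basic q.
Proof.
move=> q'q p p' s sp; have [r rs [q'' ? ?]] := p' s sp; exists r => //.
by exists q'' => //; apply: (proj_trans H) q'q.
Qed.

Lemma basic_invariant q : invariant_sets (basic q).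
Proof.
split.
  move=> p; split=> [pq r rp|Hq s sp].
    by exists r => // s sr; apply: pq; exact: cle_trans sr rp.
  have [r rs rq] := Hq s sp; have [t tr tP] := rq r (@cle_refl _ r).
  by exists t => //; exact: cle_trans tr rs.
move=> p p' q0 pq p'q Bp s sp'.
have [s' [r [q' [s's rp s'q' rq']]]] := bisimilar pq p'q sp'.
have [t tr [q1 q1q tq1]] := Bp r rp.
have [s'' s''s' s''q1] := vis_lift H s'q' (vis_mono H rq' tq1 tr).
by exists s''; [exact: cle_trans s''s' s's|exists q1].
Qed.

(** Let [p'] in [U] have visible part [q]. A condition with visible part below [q] shares it with an
    extension of [p'], so invariance puts it into [U]. *)
Lemma basic_dense U : invariant_sets U -> U <> set0 -> exists q, basic q `<=` U.
Proof.
move=> [rU iU] /eqP/set0P[p Up].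
have [p' p'p [q p'q]] := vis_dense H p; exists q => s Bs; apply/rU => t /Bs[r rt [q' q'q rq']].
have [u up' uq'] := vis_lift H p'q q'q.
exists r => //; apply: (iU _ _ _ uq' rq'); apply: regular_open_cle up' _ => //.
exact: regular_open_cle p'p Up.
Qed.

Lemma basic_compatible q q' p : basic q p -> basic q' p -> exists2 z, le z q & le z q'.
Proof.
move=> Bp B'p; have [r rp [q1 q1q rq1]] := Bp p (@cle_refl _ p).
have [s sr [q2 q2q' sq2]] := B'p r rp; exists q2 => //.
exact: (proj_trans H) (vis_mono H rq1 sq2 sr) q1q.
Qed.

End InvariantAlgebra.

(** * Almost coherent families of partial functions *)

Section AlmostCoherent.
Context {L : eqType}.

(* A condition [(n, rows)] lists the initial parts below [n] of partial functions
   f_a : nat -> bool for finitely many [a : L], [None] meaning undefined. *)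
Definition acond : Type := nat * seq (L * seq (option bool)).

Implicit Types (q r y z : acond) (a b : L) (k n : nat).

Definition supp q : seq L := map fst q.2.

(** Only the first row listed for [a] counts. The default [None] makes missing rows and positions
    past the end of a row undefined. *)
Definition value q a k : option bool :=
  nth None (odflt [::] (omap snd (ohead [seq r <- q.2 | r.1 == a]))) k.

(** Coherence is demanded only of rows already in [supp q], at positions from [q.1] on. Earlier
    disagreements remain, and a newly listed row is arbitrary below [q'.1]; this is what makes
    agreement hold only almost everywhere. *)
Definition ale q' q : Prop :=
  [/\ q.1 <= q'.1, {subset supp q <= supp q'},
      forall a k, a \in supp q -> k < q.1 -> value q' a k = value q a k &
      forall a b k u v, a \in supp q -> b \in supp q -> q.1 <= k < q'.1 ->
        value q' a k = Some u -> value q' b k = Some v -> u = v].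

Definition tabulate n (w : seq L) (g : L -> nat -> option bool) : acond :=
  (n, [seq (a, [seq g a k | k <- iota 0 n]) | a <- w]).

Lemma supp_tabulate n w g : supp (tabulate n w g) = w.
Proof. by rewrite /supp /= -map_comp map_id. Qed.

Lemma value_tabulate n w g a k :
  a \in w -> k < n -> value (tabulate n w g) a k = g a k.
Proof.
move=> aw kn; rewrite /value /=.
elim: w aw => [//|b w IH]; rewrite inE /=; case: (eqVneq b a) => [->|ba] /=.
  by move=> _; rewrite (nth_map 0) ?size_iota// nth_iota.
exact: IH.
Qed.

Lemma ale_trans q r s : ale q r -> ale r s -> ale q s.
Proof.
move=> [n1 w1 v1 c1] [n2 w2 v2 c2]; split.
- exact: leq_trans n2 n1.
- by move=> a /w2/w1.
- by move=> a k as' ks; rewrite v1 ?v2//; [exact: w2|exact: leq_trans ks n2].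
- move=> a b k u v as' bs /andP[k1 k2]; have [kr|kr] := ltnP k r.1.
    by rewrite !v1 ?w2//; apply: c2 => //; rewrite k1.
  by apply: c1; rewrite ?w2// kr.
Qed.

Lemma ale_tabulate q n w g :
  q.1 <= n -> {subset supp q <= w} ->
  (forall a k, a \in supp q -> k < q.1 -> g a k = value q a k) ->
  (forall a b k u v, a \in supp q -> b \in supp q -> q.1 <= k < n ->
     g a k = Some u -> g b k = Some v -> u = v) ->
  ale (tabulate n w g) q.
Proof.
move=> qn qw gq gc; split=> //; first by rewrite supp_tabulate.
  by move=> a k aq kq; rewrite value_tabulate ?gq ?qw//; exact: leq_trans kq qn.
move=> a b k u v aq bq /andP[k1 k2]; rewrite !value_tabulate ?qw//.
by apply: gc; rewrite ?k1.
Qed.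

Definition restr q (M : set L) : acond :=
  tabulate q.1 [seq a <- supp q | `[< M a >]] (value q).

Lemma supp_restr q M a : a \in supp (restr q M) <-> a \in supp q /\ M a.
Proof.
rewrite supp_tabulate mem_filter; split=> [/andP[/asboolP]//|[? ?]].
by apply/andP; split=> //; apply/asboolP.
Qed.

Lemma value_restr q M a k :
  a \in supp q -> M a -> k < q.1 -> value (restr q M) a k = value q a k.
Proof.
by move=> aq Ma kq; rewrite value_tabulate// mem_filter aq andbT; apply/asboolP.
Qed.

Lemma ale_restr q M : ale q (restr q M).
Proof.
split=> //; first by move=> a /supp_restr[].
  by move=> a k /supp_restr[aq Ma] kq; rewrite value_restr.
by move=> a b k u v _ _ /andP[h1 h2]; rewrite leqNgt h2 in h1.
Qed.

Definition in_supp q (M : set L) : Prop := forall a, a \in supp q -> M a.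

(** Rows of [y] are kept as they are, and the remaining rows of [q] stay undefined from [q.1] on, so
    they cannot clash. The rows common to [y] and [q] lie in [M], where [y] is already coherent. *)
Lemma restr_compatible q y M N :
  ale y (restr q M) -> in_supp y M -> in_supp y N -> in_supp q N ->
  exists z, [/\ ale z y, ale z q & in_supp z N].
Proof.
move=> [n1 w1 v1 c1] yM yN qN.
exists (tabulate y.1 (supp y ++ supp q) (fun a k =>
  if a \in supp y then value y a k else if k < q.1 then value q a k else None)).
split.
- apply: ale_tabulate => //; first by move=> a ay; rewrite mem_cat ay.
    by move=> a k ->.
  by move=> a b k u v _ _ /andP[h1 h2]; rewrite leqNgt h2 in h1.
- apply: ale_tabulate => //.
  + by move=> a ay; rewrite mem_cat ay orbT.
  + move=> a k aq kq; case: ifP => [ay|_]; last by rewrite kq.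
    by have Ma := yM _ ay; rewrite v1 ?value_restr//; apply/supp_restr.
  + move=> a b k u v aq bq /andP[k1 k2].
    rewrite [k < q.1]ltnNge k1 /=; case: ifP => // ay; case: ifP => // bY.
    by apply: c1; rewrite ?k1//; apply/supp_restr; split=> //; exact: yM.
- by move=> a; rewrite supp_tabulate mem_cat => /orP[/yN|/qN].
Qed.

Definition extend q (M : set L) (v : L -> option bool) : acond :=
  tabulate q.1.+1 [seq a <- supp q | `[< M a >]]
    (fun a k => if k < q.1 then value q a k else v a).

Lemma supp_extend q M v a : a \in supp (extend q M v) <-> a \in supp q /\ M a.
Proof. by rewrite -(supp_restr q M a) !supp_tabulate. Qed.

Lemma value_extend q M v a k : a \in supp q -> M a -> k <= q.1 ->
  value (extend q M v) a k = if k < q.1 then value q a k else v a.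
Proof.
move=> aq Ma kq; rewrite value_tabulate// mem_filter aq andbT; exact/asboolP.
Qed.

(** A new column with at most one defined entry cannot violate coherence. *)
Lemma ale_extend q M v (c : L) : (forall a, a != c -> v a = None) ->
  ale (extend q M v) (restr q M).
Proof.
move=> vc; split; first exact: leqnSn.
- by move=> a; rewrite !supp_tabulate.
- move=> a k /supp_restr[aq Ma] kq.
  by rewrite value_restr// value_extend// ?kq// ltnW.
- move=> a b k u w /supp_restr[aq Ma] /supp_restr[bq Mb] /andP[k1 k2].
  rewrite !value_extend// ltnNge k1 /=.
  case: (eqVneq a c) => [->|/vc -> //]; case: (eqVneq b c) => [->|/vc -> //].
  by move=> -> [].
Qed.

Lemma ale_restr_extend q M N X v v' :
  X `<=` M -> X `<=` N -> (forall a, X a -> v a = v' a) ->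
  ale (restr (extend q M v) X) (restr (extend q N v') X).
Proof.
move=> XM XN vv'; split=> //.
- move=> a /supp_restr[/supp_extend[aq _] Xa]; apply/supp_restr.
  by split=> //; apply/supp_extend; split=> //; exact: XM.
- move=> a k /supp_restr[/supp_extend[aq _] Xa] kq.
  have Ma := XM _ Xa; have Na := XN _ Xa.
  rewrite !value_restr ?value_extend//; try exact/supp_extend.
  by rewrite vv'.
- by move=> a b k u w _ _ /andP[h1 h2]; rewrite leqNgt h2 in h1.
Qed.

Lemma countable_in_supp {C : set L} : countable C -> countable [set q | in_supp q C].
Proof.
move=> cC.
have cD : countable [set l : seq (L * seq (option bool)) | forall x, List.In x l -> C x.1].
  have -> : [set l : seq (L * seq (option bool)) | forall x, List.In x l -> C x.1] =
    [set l | forall x, List.In x l -> (C `*` [set: seq (option bool)]) x].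
    by rewrite predeqE => l; split=> h x xl; [split=> //; exact: h|have [] := h x xl].
  by apply: countable_lists; apply: countableX.
apply: (@sub_countable _ _ _ ([set: nat] `*` _) _ (countableX (countableP _) cD)).
apply: subset_card_le => -[n l] qC; split=> //= x xl; apply: qC.
elim: l xl => [//|y l IH] [->|/IH h]; rewrite /supp /= inE ?eqxx//.
by apply/orP; right; exact: h.
Qed.

End AlmostCoherent.
Arguments acond : clear implicits.

(** * Coding by Cohen reals *)

(* Cohen reals on [coord L] code a total function C = [common] and, for a : L,
   a domain ([defined]), junk values ([junk]) and the position of the first 1
   of [marker], from which on f_a follows C. *)
Inductive coord (L : Type) : Type :=
  | common of nat | defined of L & nat | junk of L & nat | marker of L & nat.
Arguments common {L} _.

(** The four kinds of coordinates are told apart by residues modulo 4; the common real occupies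
    residue 0 of the single row [l0]. *)
Lemma coord_injection {L : eqType} {T : Type} (i : L -> nat -> T) (l0 : L) :
  (forall a b k l, i a k = i b l -> a = b /\ k = l) ->
  exists c : coord L -> T, injective c.
Proof.
move=> inj.
exists (fun x => match x with
  | common k => i l0 (k * 4) | defined a k => i a (k * 4 + 1)
  | junk a k => i a (k * 4 + 2) | marker a k => i a (k * 4 + 3) end).
have key r s k l : r < 4 -> s < 4 -> k * 4 + r = l * 4 + s -> k = l /\ r = s.
  move=> r4 s4 e; have := congr1 (divn^~ 4) e; have := congr1 (modn^~ 4) e.
  by rewrite /= !modnMDl !divnMDl// !modn_small// !divn_small// !addn0.
have key0 s k l : s < 4 -> k * 4 = l * 4 + s -> k = l /\ 0 = s.
  by move=> s4 e; apply: key => //; rewrite addn0.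
have key1 s k l : s < 4 -> l * 4 + s = k * 4 -> k = l /\ 0 = s.
  by move=> s4 e; apply: key0.
case=> [k|a k|a k|a k] [l|b l|b l|b l] /inj[ab].
- by move=> /eqP; rewrite eqn_pmul2r// => /eqP ->.
all: try by move=> /key0[].
all: try by move=> /key1[].
all: by move=> /key[] // <-; rewrite ab.
Qed.

Lemma In_map {A B : Type} (f : A -> B) y (s : seq A) :
  List.In y s -> List.In (f y) (map f s).
Proof. by elim: s => //= z s IH [->|/IH]; [left|right]. Qed.

Lemma In_mem {A : eqType} (y : A) (s : seq A) : y \in s -> List.In y s.
Proof. by elim: s => //= z s IH; rewrite inE => /orP[/eqP->|/IH]; [left|right]. Qed.

Lemma In_cat {A : Type} (y : A) (s t : seq A) :
  List.In y s \/ List.In y t -> List.In y (s ++ t).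
Proof.
by elim: s => [[]//|z s IH] /= [[]|]; [left|right; apply: IH; left|right; apply: IH; right].
Qed.

Lemma In_flatten {A : Type} (y : A) s (ss : seq (seq A)) :
  List.In s ss -> List.In y s -> List.In y (flatten ss).
Proof. by elim: ss => //= z ss IH [->|h] h2; apply: In_cat; [left|right; apply: IH]. Qed.

Section Realization.
Context {L : eqType} {T : Type} (code : coord L -> T).
Hypothesis code_inj : injective code.
Implicit Types (p : Cond T) (q : acond L) (a b : L).

Definition bit p c := sval p (code c).

Definition first_marker p a m :=
  bit p (marker a m) = Some true /\ forall j, j < m -> bit p (marker a j) = Some false.

Definition reads p a m k (o : option bool) :=
  if o is Some u then bit p (defined a k) = Some true /\
    (if k < m then bit p (junk a k) else bit p (common k)) = Some u
  else bit p (defined a k) = Some false.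

(** The bound [m <= q.1] says that every listed row follows the common real from [q.1] on, and
    exactly there the common bits are still undecided. Junk and marker bits of a listed row beyond
    its first marker are invisible and left unrestricted. *)
Definition vis p q : Prop :=
  [/\ forall k, bit p (common k) <> None <-> k < q.1,
      forall a k, a \notin supp q -> [/\ bit p (defined a k) = None,
        bit p (junk a k) = None & bit p (marker a k) = None],
      forall a k, q.1 <= k -> bit p (defined a k) = None &
      forall a, a \in supp q -> exists m, [/\ first_marker p a m, m <= q.1 &
        forall k, k < q.1 -> reads p a m k (value q a k)]].

Lemma first_marker_inj p a m m' : first_marker p a m -> first_marker p a m' -> m = m'.
Proof.
move=> [m1 m2] [m1' m2']; case: (ltngtP m m') => // h.
  by have := m2' _ h; rewrite m1.
by have := m2 _ h; rewrite m1'.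
Qed.

Lemma first_marker_cle p p' a m : cle p' p -> first_marker p a m -> first_marker p' a m.
Proof. by move=> pp' [m1 m2]; split=> [|j /m2]; apply: pp'. Qed.

Lemma reads_cle p p' a m k o : cle p' p -> reads p a m k o -> reads p' a m k o.
Proof.
move=> pp'; case: o => [u|] /=; last exact: pp'.
by case: ifP => _ [h1 h2]; split; apply: pp'.
Qed.

Lemma reads_inj p a m k o o' : reads p a m k o -> reads p a m k o' -> o = o'.
Proof.
case: o o' => [u|] [v|] //=; first by move=> [_ ->] [_].
  by move=> [->].
by move=> -> [].
Qed.

(** Coherence holds because rows of [supp q] have their first marker at or below [q.1]: whatever
    they show from there on is a bit of the common real. *)
Lemma vis_ale p q p' q' : vis p q -> vis p' q' -> cle p' p -> ale q' q.
Proof.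
move=> [n1 w1 d1 f1] [n2 w2 d2 f2] pp'.
have qq' : q.1 <= q'.1.
  rewrite leqNgt; apply/negP => /n1; case e : (bit p _) => [u|//] _.
  have := pp' _ _ e; rewrite -[sval p' _]/(bit p' _) => e'.
  by have := (n2 q'.1).1; rewrite e' ltnn; case.
have ss' : {subset supp q <= supp q'}.
  move=> a /f1[m [[am _] _ _]]; apply: contrapT => /negP /(w2 a m)[_ _].
  by rewrite /bit (pp' _ _ am).
split=> //.
  move=> a k aq kq; have [m [m1 _ r1]] := f1 a aq; have [m' [m2 _ r2]] := f2 a (ss' a aq).
  have := first_marker_inj (first_marker_cle pp' m1) m2 => e; rewrite -e in r2.
  apply: reads_inj (r2 k (leq_trans kq qq')) _; exact: reads_cle pp' (r1 k kq).
have common_value a k u : a \in supp q -> q.1 <= k < q'.1 ->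
    value q' a k = Some u -> bit p' (common k) = Some u.
  move=> aq /andP[k1 k2] ea; have [m [m1 mq r1]] := f1 a aq.
  have [m' [m2 _ r2]] := f2 a (ss' a aq).
  have := first_marker_inj (first_marker_cle pp' m1) m2 => e; rewrite -e in r2.
  by have := r2 k k2; rewrite ea /= ltnNge (leq_trans mq k1) /= => -[].
move=> a b k u v aq bq kk /common_value ea /common_value eb.
by have := ea aq kk; rewrite eb// => -[].
Qed.

(** Markers range up to [n] inclusive, so that a row can have its first marker at [n] and show only
    junk below [n]. *)
Definition rect n (w : seq L) (c : coord L) : bool :=
  match c with
  | common k => k < n | defined a k => (a \in w) && (k < n)
  | junk a k => (a \in w) && (k < n) | marker a k => (a \in w) && (k <= n) end.

Lemma fill p n w (x : coord L -> bool) : exists2 p', cle p' p &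
  forall c, bit p' c = if bit p c is Some u then Some u
                       else if rect n w c then Some (x c) else None.
Proof.
pose l : seq (coord L) := [seq common k | k <- iota 0 n] ++
  flatten [seq flatten [seq [:: defined a k; junk a k; marker a k] | k <- iota 0 n.+1] | a <- w].
have rl c : rect n w c -> List.In (code c) (map code l).
  move=> rc; apply: In_map; apply: In_cat.
  have key a k c' : a \in w -> k <= n ->
      List.In c' [:: defined a k; junk a k; marker a k] ->
      List.In c' (flatten [seq flatten [seq [:: defined a k; junk a k; marker a k]
         | k <- iota 0 n.+1] | a <- w]).
    move=> aw kn cc; apply: In_flatten; first by apply: In_map; exact: In_mem aw.
    by apply: In_flatten cc; apply: In_map; apply: In_mem; rewrite mem_iota.
  case: c rc => [k kn|a k /andP[aw kn]|a k /andP[aw kn]|a k /andP[aw kn]].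
  - by left; apply: In_map; apply: In_mem; rewrite mem_iota.
  - by right; apply: (key a k) => //=; [exact: ltnW|left].
  - by right; apply: (key a k) => //=; [exact: ltnW|right; left].
  - by right; apply: (key a k) => //=; right; right; left.
have [s sP] := svalP p.
pose f t := if sval p t is Some u then Some u else
  if pselect (exists2 c, rect n w c & code c = t) is left h
  then Some (x (s2val (cid2 h))) else None.
have [|p' ep'] := @cond_of_fun _ f (s ++ map code l).
  move=> t ft; apply: In_cat; move: ft; rewrite /f.
  case e : (sval p t) => [u|]; first by move=> _; left; apply: sP; rewrite e.
  by case: pselect => // h _; right; case: h => c rc <-; exact: rl.
exists p'; first by move=> t u pt; rewrite ep' /f pt.
move=> c; rewrite /bit ep' /f; case: (sval p _) => //.
case: pselect => [h|nh]; first by case: (cid2 h) => /= c' rc' /code_inj <-; rewrite rc'.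
by case: ifP => // rc; case: nh; exists c.
Qed.

Lemma vis_extend p q q' : vis p q -> ale q' q -> exists2 p', cle p' p & vis p' q'.
Proof.
move=> [n1 w1 d1 f1] [qq' ss' vv' coh].
(* The common bit at a new position is the value shown by the old rows, unique by coherence and
   [false] if none is defined. A new row gets its first marker at [q'.1], so its values are all junk
   and hence arbitrary. *)
pose x c := match c with
  | common k => `[< exists2 a, a \in supp q & value q' a k = Some true >]
  | defined a k => isSome (value q' a k)
  | junk a k => odflt false (value q' a k)
  | marker a k => k == q'.1 end.
have [p' pp' ep'] := fill p q'.1 (supp q') x; exists p' => //.
have pcom k : q.1 <= k -> bit p (common k) = None.
  move=> qk; case e : (bit _ _) => [u|//]; have := (n1 k).1.
  by rewrite e ltnNge qk => h; suff : false by []; apply: h.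
split.
- move=> k; rewrite ep'; case e : (bit p _) => [u|] /=; last by case: ifP.
  by split=> // _; apply: leq_trans qq'; apply/n1; rewrite e.
- move=> a k aq'; have aq : a \notin supp q by apply: contra aq'; exact: ss'.
  by have [e1 e2 e3] := w1 a k aq; rewrite !ep' e1 e2 e3 /= (negbTE aq').
- by move=> a k qk; rewrite ep' d1 ?(leq_trans qq')// /= ltnNge qk andbF.
move=> a aq'; case: (boolP (a \in supp q)) => aq.
  have [m [m1 mq r1]] := f1 a aq; exists m; split.
  - exact: first_marker_cle pp' m1.
  - exact: leq_trans mq qq'.
  move=> k kq'; have [kq|kq] := ltnP k q.1.
    by rewrite vv'//; apply: reads_cle pp' (r1 k kq).
  rewrite /reads !ep' d1//= aq' kq' pcom//= ltnNge (leq_trans mq kq) /=.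
  case ev : (value q' a k) => [u|]//; split=> //; congr Some.
  case: asboolP => [[b bq bv]|nb].
    by apply: (coh b a k) => //; rewrite kq.
  by case: u ev => // ev; case: nb; exists a.
have pN k := w1 a k aq.
exists q'.1; split=> //.
  split; first by rewrite ep'; have [_ _ ->] := pN q'.1; rewrite /= aq' leqnn eqxx.
  by move=> j jq; rewrite ep'; have [_ _ ->] := pN j; rewrite /= aq' ltnW//= ltn_eqF.
move=> k kq; have [e1 e2 _] := pN k; rewrite /reads !ep' e1 e2 /= aq' kq /=.
by case: (value q' a k).
Qed.

Lemma vis_complete p : exists2 p', cle p' p & exists q, vis p' q.
Proof.
have [s sP] := svalP p.
(* The bound is strict for markers too, leaving the marker at position [n] undecided by [p]. *)
pose inside n (w : seq L) (c : coord L) := match c with common k => k < n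
  | defined a k | junk a k | marker a k => (a \in w) && (k < n) end.
have [n [w nwP]] : exists n w, forall c, List.In (code c) s -> inside n w c.
  elim: s {sP} => [|t s [n [w nwP]]]; first by exists 0, [::].
  have [[c ct]|nex] := pselect (exists c, code c = t); last first.
    exists n, w => c [ct|/nwP//]; by case: nex; exists c.
  pose w' := match c with common _ => w | defined a _ | junk a _ | marker a _ => a :: w end.
  pose n' := match c with common k | defined _ k | junk _ k | marker _ k => k.+1 end.
  exists (maxn n n'), w' => c' [].
    rewrite -ct => /code_inj <-; rewrite /w' /n'.
    by case: c {w' n' ct} => [k|a k|a k|a k]; rewrite /= ?inE ?eqxx leq_max ltnSn orbT.
  move/nwP; have ww' b : b \in w -> b \in w'.
    by rewrite /w'; case: c {w' n' ct} => [k|a k|a k|a k] bw; rewrite ?inE ?bw ?orbT.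
  case: c' => [k|a k|a k|a k] /=; first by rewrite leq_max => ->.
  - by move=> /andP[/ww' aw' kn]; rewrite /= aw' leq_max kn.
  - by move=> /andP[/ww' aw' kn]; rewrite /= aw' leq_max kn.
  - by move=> /andP[/ww' aw' kn]; rewrite /= aw' leq_max kn.
have pn c : bit p c <> None -> inside n w c by move=> h; exact: nwP (sP _ h).
have pnN c : ~~ inside n w c -> bit p c = None.
  by move=> h; apply: contrapT => /pn; apply/negP.
have pnw a k : a \notin w -> [/\ bit p (defined a k) = None,
    bit p (junk a k) = None & bit p (marker a k) = None].
  by move=> aw; split; apply: pnN; rewrite /= (negbTE aw).
have pnd a k : n <= k -> bit p (defined a k) = None.
  by move=> nk; apply: pnN; rewrite /= ltnNge nk andbF.
have pnm a : bit p (marker a n) = None by apply: pnN; rewrite /= ltnn andbF.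
(* Setting the free marker at [n] gives every row of [w] a first marker at or below [n]. *)
pose x (c : coord L) := if c is marker a k then k == n else false.
have [p' pp' ep'] := fill p n w x; exists p' => //.
have p'S c : rect n w c -> exists u, bit p' c = Some u.
  by move=> rc; rewrite ep' rc; case: (bit p c) => [u|]; eexists.
have [m mP] : {m : L -> nat & forall a, a \in w -> first_marker p' a (m a) /\ m a <= n}.
  apply: (choice (P := fun a m => a \in w -> first_marker p' a m /\ m <= n)) => a.
  have [aw|aw] := boolP (a \in w); last by exists 0.
  have ex : exists k, bit p' (marker a k) == Some true.
    by exists n; rewrite ep' pnm /= aw leqnn eqxx.
  case: (ex_minnP ex) => k /eqP ek kmin; exists k => _.
  have kn : k <= n.
    by apply: kmin; rewrite ep' pnm /= aw leqnn eqxx.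
  split=> //; split=> // j jk.
  have [|u eu] := p'S (marker a j); first by rewrite /= aw (leq_trans (ltnW jk)).
  case: u eu => // eu; have := kmin j; rewrite eu eqxx => /(_ isT).
  by rewrite leqNgt jk.
have [g gP] : {g : L * nat -> option bool & forall ak, ak.1 \in w -> ak.2 < n ->
    reads p' ak.1 (m ak.1) ak.2 (g ak)}.
  apply: (choice (P := fun ak o => ak.1 \in w -> ak.2 < n ->
    reads p' ak.1 (m ak.1) ak.2 o)) => -[a k] /=.
  have [aw|aw] := boolP (a \in w); last by exists None.
  have [kn|kn] := ltnP k n; last by exists None.
  have [|u eu] := p'S (defined a k); first by rewrite /= aw.
  have [|v ev] := p'S (junk a k); first by rewrite /= aw.
  have [|v' ev'] := p'S (common k); first by [].
  case: u eu => eu; last by exists None.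
  by exists (Some (if k < m a then v else v')) => _ _; split=> //; case: ifP.
exists (tabulate n w (fun a k => g (a, k))); split; rewrite ?supp_tabulate /=.
- move=> k; split=> [|kn]; last by have [|u ->] := p'S (common k).
  by rewrite ep'; case e : (bit p _) => [u|]; [move=> _; apply: (pn (common k)); rewrite e|case: ifP].
- by move=> a k aw; have [e1 e2 e3] := pnw a k aw; rewrite !ep' e1 e2 e3 /= (negbTE aw).
- by move=> a k nk; rewrite ep' pnd//= ltnNge nk andbF.
- move=> a aw; have [m1 mn] := mP a aw; exists (m a); split=> // k kn.
  by rewrite value_tabulate//; apply: (gP (a, k)).
Qed.

Lemma vis_projection : projection ale vis.
Proof.
split.
- exact: ale_trans.
- exact: vis_complete.
- exact: vis_ale.
- exact: vis_extend.
(* Every [q] is below [(0, [::])], the visible part of the empty condition. *)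
move=> q; have [|p0 ep0] := @cond_of_fun T (fun _ => None) [::]; first by [].
have [||p _ pq] := @vis_extend p0 (0, [::]) q; last by exists p.
- by split=> //; rewrite /bit ep0.
- by split.
Qed.

End Realization.

(** * Non-isomorphism with the Cohen algebra *)

(** Closing off in omega steps suffices: the support of [w] is finite, so if it lies in the union it
    lies in one stage. *)
Lemma countable_closure {K W : Type} (sp out : W -> set K) (C : set K) :
  (forall w, exists s : seq K, forall x, sp w x -> List.In x s) ->
  (forall D, countable D -> countable [set w | sp w `<=` D]) ->
  (forall w, countable (out w)) -> countable C ->
  exists M, [/\ countable M, C `<=` M & forall w, sp w `<=` M -> out w `<=` M].
Proof.
move=> fsp csp cout cC.
pose step (D : set K) := D `|` \bigcup_(w in [set w | sp w `<=` D]) out w.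
pose M n := iter n step C.
have Mmono n m : n <= m -> M n `<=` M m.
  move=> /subnK <-; elim: (m - n) => [//|d IH] x /IH Mx; by left.
exists (\bigcup_n M n); split.
- apply: bigcup_countable => // n _; elim: n => [//|n IH] /=.
  by apply: countable_setU => //; apply: bigcup_countable; [exact: csp|move=> w _; exact: cout].
- by move=> x Cx; exists 0.
- move=> w spM x xw; have [s sP] := fsp w.
  have [n nP] : exists n, forall y, List.In y s -> (\bigcup_n M n) y -> M n y.
    elim: s {sP} => [|y s [n nP]]; first by exists 0.
    have [[m _ My]|ny] := pselect ((\bigcup_n M n) y); last first.
      by exists n => z [<- //|]; exact: nP.
    exists (maxn n m) => z [<- _|zs Mz]; first exact: Mmono (leq_maxr n m) _ My.
    exact: Mmono (leq_maxl n m) _ (nP z zs Mz).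
  exists n.+1 => //; right; exists w => // y yw; apply: nP; first exact: sP.
  exact: spM.
Qed.

Lemma countable_cond {T : Type} (C : set T) : countable C ->
  countable [set c : Cond T | forall t, sval c t <> None -> C t].
Proof.
move=> cC.
have [g gP] : {g : Cond T -> seq (T * bool) &
    forall c t b, List.In (t, b) (g c) <-> sval c t = Some b}.
  apply: (choice (P := fun c l => forall t b, List.In (t, b) l <-> sval c t = Some b)) => c.
  have [s sP] := svalP c.
  suff [l lP] : exists l, forall t b, List.In (t, b) l <-> List.In t s /\ sval c t = Some b.
    exists l => t b; rewrite lP; split=> [[]//|e]; split=> //; by apply: sP; rewrite e.
  elim: s {sP} => [|u s [l lP]]; first by exists [::] => t b; split=> [|[]].
  case e : (sval c u) => [v|]; last first.
    exists l => t b; rewrite lP; split=> [[h1 h2]|[[<-|h1] h2]] //; first by split=> //; right.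
    by rewrite e in h2.
  exists ((u, v) :: l) => t b; split.
    by case=> [[<- <-]|/lP[h1 h2]]; split=> //; [left|right].
  case=> [[<-|h1] h2]; first by left; move: h2; rewrite e => -[->].
  by right; apply/lP.
have cD : countable [set l : seq (T * bool) | forall x, List.In x l -> (C `*` [set: bool]) x].
  by apply: countable_lists; apply: countableX.
apply: (countable_inj (f := g) cD); first by move=> c Cc -[t b] /gP e; split=> //; apply: Cc; rewrite e.
move=> c d _ _ e; apply: sval_inj; apply: funext => t.
case ec : (sval c t) => [b|]; first by apply/esym/gP; rewrite -e; apply/gP.
by case ed : (sval d t) => [b|//]; move/gP: ed; rewrite -e => /gP; rewrite ec.
Qed.

Lemma cond_cut {T : Type} (c : Cond T) (M : set T) :
  exists c' : Cond T, forall t b, sval c' t = Some b <-> M t /\ sval c t = Some b.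
Proof.
have [s sP] := svalP c.
have [|c' ec'] := @cond_of_fun _ (fun t => if `[< M t >] then sval c t else None) s.
  by move=> t; case: ifP => // _; exact: sP.
exists c' => t b; rewrite ec'; case: asboolP => Mt; first by split=> [|[]].
by split=> [|[]].
Qed.

Lemma cond_union {T : Type} (c d : Cond T) :
  (forall t u v, sval c t = Some u -> sval d t = Some v -> u = v) ->
  exists e : Cond T, [/\ cle e c, cle e d &
    forall t b, sval e t = Some b -> sval c t = Some b \/ sval d t = Some b].
Proof.
move=> cd; have [s sP] := svalP c; have [s' sP'] := svalP d.
have [|e ee] := @cond_of_fun _ (fun t => if sval c t is Some b then Some b else sval d t) (s ++ s').
  move=> t; case ec : (sval c t) => [b|] h; apply: In_cat.
    by left; apply: sP; rewrite ec.
  by right; apply: sP'.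
exists e; split.
- by move=> t b ct; rewrite ee ct.
- move=> t b dt; rewrite ee; case ec : (sval c t) => [u|//].
  by rewrite (cd t u b ec dt).
- by move=> t b; rewrite ee; case: (sval c t) => [u|]; [left|right].
Qed.

(** * Closing off under a supposed isomorphism *)

Section NotCohen.
(** [Phi q] stands for the image of [basic q] under a supposed isomorphism onto the Cohen algebra.
    In [Phi_meet] surjectivity enters: below any Cohen condition there is some nonempty [Phi z]. *)
Context {L : eqType} {T : Type} (Phi : acond L -> set (Cond T)).
Hypothesis Phi_cle : forall q c c', Phi q c -> cle c' c -> Phi q c'.
Hypothesis Phi_neq0 : forall q, Phi q !=set0.
Hypothesis Phi_ale : forall q q', ale q' q -> Phi q' `<=` Phi q.
Hypothesis Phi_meet : forall q q' c, Phi q c -> Phi q' c ->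
  exists z, [/\ ale z q, ale z q' & Phi z `<=` below c].

Definition joint_supp (w : acond L * Cond T) : set (L + T) :=
  [set x | match x with inl a => is_true (a \in supp w.1) | inr t => sval w.2 t <> None end].

Definition over (M : set (L + T)) (q : acond L) := in_supp q (fun a => M (inl a)).
Definition cond_over (M : set (L + T)) (c : Cond T) :=
  forall t, sval c t <> None -> M (inr t).

(* Replaces "F(M) = C(M)" for a countable elementary submodel M. *)
Definition skolem_closed (M : set (L + T)) : Prop :=
  [/\ forall q, over M q -> exists2 c, cond_over M c & Phi q c,
      forall q c, over M q -> cond_over M c -> ~ Phi q `<=` below c ->
        exists q', [/\ over M q', ale q' q & Phi q' `&` below c = set0] &
      forall q c, over M q -> cond_over M c -> Phi q `&` below c !=set0 ->
        exists q', [/\ over M q', ale q' q & Phi q' `<=` below c]].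

(** The three components of [o] answer the three clauses of [skolem_closed]. *)
Definition skolem_witness (w : acond L * Cond T) (o : Cond T * acond L * acond L) : Prop :=
  [/\ Phi w.1 o.1.1,
      ~ Phi w.1 `<=` below w.2 -> ale o.1.2 w.1 /\ Phi o.1.2 `&` below w.2 = set0 &
      Phi w.1 `&` below w.2 !=set0 -> ale o.2 w.1 /\ Phi o.2 `<=` below w.2].

Lemma skolem_witness_exists w : exists o, skolem_witness w o.
Proof.
case: w => q c; have [c0 c0P] := Phi_neq0 q.
have [q1 q1P] : exists q1, ~ Phi q `<=` below c -> ale q1 q /\ Phi q1 `&` below c = set0.
  have [s|ns] := pselect (Phi q `<=` below c); first by exists q.
  have [d [qd /not_cle_incompatible[d' d'd dn]]] : exists d, Phi q d /\ ~ cle d c.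
    by move/existsNP: ns => [d /not_implyP[? ?]]; exists d.
  have qd' := Phi_cle qd d'd; have [z [zq _ zd']] := Phi_meet qd' qd'.
  exists z => _; split=> //; rewrite predeqE => e; split=> // -[/zd' ed' ec].
  exact: dn ed' ec.
have [q2 q2P] : exists q2, Phi q `&` below c !=set0 -> ale q2 q /\ Phi q2 `<=` below c.
  have [[d [qd dc]]|ns] := pselect (Phi q `&` below c !=set0); last by exists q.
  have [z [zq _ zd]] := Phi_meet qd qd; exists z => _; split=> // e /zd ed.
  exact: cle_trans ed dc.
by exists (c0, q1, q2).
Qed.

(* The countable closed sets used here are all closed under the same Skolem
   functions, hence so are their intersections. *)
Lemma skolem_hull : exists closed : set (set (L + T)),
  [/\ forall C, countable C -> exists M, [/\ countable M, C `<=` M & closed M],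
      forall M N, closed M -> closed N -> closed (M `&` N) &
      forall M, closed M -> skolem_closed M].
Proof.
have [o oP] : {o : acond L * Cond T -> Cond T * acond L * acond L &
    forall w, skolem_witness w (o w)} by apply: choice => w; exact: skolem_witness_exists.
pose out w := joint_supp ((o w).1.2, (o w).1.1) `|` joint_supp ((o w).2, (o w).1.1).
have fsupp w : exists s : seq (L + T), forall x, joint_supp w x -> List.In x s.
  case: w => q c; have [s sP] := svalP c; exists (map inl (supp q) ++ map inr s).
  move=> [a /= aq|t /= tc]; apply: In_cat; [left|right]; apply: In_map.
    exact: In_mem aq.
  exact: sP.
have csupp w : countable (joint_supp w).
  have [s sP] := fsupp w.
  have : finite_set [set x | List.In x s].
    elim: s {sP} => [|x s IH]; first by apply: sub_finite_set (finite_set0 _) => x [].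
    have -> : [set y | List.In y (x :: s)] = x |` [set y | List.In y s].
      by rewrite predeqE => y; split=> [[->|]|[->|]]; by [left|right].
    by rewrite finite_setU; split.
  by move/finite_set_countable; apply: sub_countable; exact: subset_card_le.
exists [set M | forall w, joint_supp w `<=` M -> out w `<=` M]; split.
- move=> C cC; apply: countable_closure cC => //; last first.
    by move=> w; apply: countable_setU.
  move=> D cD.
  have cq : countable [set q : acond L | in_supp q (fun a => D (inl a))].
    apply: countable_in_supp; apply: (countable_inj (f := inl) cD) => //.
    by move=> a b _ _ [].
  have cc : countable [set c : Cond T | forall t, sval c t <> None -> D (inr t)].
    apply: countable_cond; apply: (countable_inj (f := inr) cD) => //.
    by move=> a b _ _ [].
  apply: sub_countable (countableX cq cc); apply: subset_card_le => -[q c] qcD.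
  by split=> [a aq|t ct] /=; apply: qcD.
- move=> M N cM cN w wMN x xw; split; [apply: (cM w) => //|apply: (cN w) => //].
    by move=> y /wMN[].
  by move=> y /wMN[].
move=> M cM.
have key q c : over M q -> cond_over M c -> out (q, c) `<=` M.
  by move=> qM cM'; apply: cM => -[a|t] /=; [exact: qM|exact: cM'].
(* The empty condition is a dummy partner for [q] in the first clause, adding nothing to the
   support. *)
have [e0 ee0] := @cond_of_fun T (fun _ => None) [::] (fun t => fun h => h erefl).
split.
- move=> q qM; have [o1 _ _] := oP (q, e0); exists (o (q, e0)).1.1 => // t ot.
  by apply: (key q e0 qM); [move=> u; rewrite ee0|left].
- move=> q c qM cM' ns; have [_ /(_ ns)[? ?] _] := oP (q, c).
  by exists (o (q, c)).1.2; split=> // a aq; apply: (key q c qM cM'); left.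
- move=> q c qM cM' ns; have [_ _ /(_ ns)[? ?]] := oP (q, c).
  by exists (o (q, c)).2; split=> // a aq; apply: (key q c qM cM'); right.
Qed.

(** What [q] forces about coordinates in [M] is forced by its part in [M]. Otherwise closure yields
    [q'] over [M] below that part and incompatible with [pM], yet [q'] amalgamates with [q]. *)
Lemma restr_below M q (p pM : Cond T) :
  skolem_closed M -> Phi q `<=` below p ->
  (forall t b, sval pM t = Some b <-> M (inr t) /\ sval p t = Some b) ->
  Phi (restr q (fun a => M (inl a))) `<=` below pM.
Proof.
move=> [_ Mn _] qp pMP; apply: contrapT => ns.
have [||q' [q'M q'q q'p]] := Mn _ pM _ _ ns.
- by move=> a /supp_restr[].
- by move=> t; case e : (sval pM t) => [b|//] _; case/pMP: e.
have [z [zq' zq _]] := restr_compatible (N := setT) q'q q'M (fun _ _ => I) (fun _ _ => I).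
have [c cz] := Phi_neq0 z.
suff : set0 c by []; rewrite -q'p; split; first exact: Phi_ale cz.
by move=> t b /pMP[_ pt]; apply: (qp c) => //; exact: Phi_ale cz.
Qed.

Lemma not_cohen : ~ card_is_aleph2 [set: L].
Proof.
move=> hL; have [closed [hull closedI closedS]] := skolem_hull.
have [M MP] : {M : L -> set (L + T) & forall a,
    [/\ countable (M a), M a (inl a) & closed (M a)]}.
  apply: (choice (P := fun a M => [/\ countable M, M (inl a) & closed M])) => a.
  have [M [cM aM clM]] := hull [set inl a] (countable1 _).
  by exists M; split=> //; exact: aM.
have [a [b [nab nba]]] : exists a b, ~ M a (inl b) /\ ~ M b (inl a).
  apply: (free_pair (M := fun a b => M a (inl b))) hL _ => a.
  have [cM _ _] := MP a; apply: (countable_inj (f := inl) cM) => //.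
  by move=> x y _ _ [].
have [_ aMa clA] := MP a; have [_ bMb clB] := MP b.
set A := M a in aMa clA nab; set B := M b in bMb clB nba.
have clX := closedI _ _ clA clB; set X := A `&` B in clX.
have [A1 A2 A3] := closedS _ clA; have [B1 B2 B3] := closedS _ clB.
have [X1 X2 X3] := closedS _ clX.
(* [r0] lists [a] and [b] at length 0, so it forbids f_a and f_b to disagree anywhere. The Cohen
   condition [p] forces [r0]; the goal is to force a disagreement below [p]. *)
pose r0 : acond L := tabulate 0 [:: a; b] (fun _ _ => None).
have [p r0p] := Phi_neq0 r0.
have [r [rr0 _ rp]] := Phi_meet r0p r0p.
have [_ r0r _ _] := rr0.
have ar : a \in supp r by apply: r0r; rewrite supp_tabulate inE eqxx.
have br : b \in supp r by apply: r0r; rewrite supp_tabulate !inE eqxx orbT.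
have [pA pAP] := cond_cut p (fun t => A (inr t)).
have [pB pBP] := cond_cut p (fun t => B (inr t)).
have rA := restr_below (closedS _ clA) rp pAP.
have rB := restr_below (closedS _ clB) rp pBP.
set LA := fun a => A (inl a) in rA; set LB := fun a => B (inl a) in rB.
(* The disagreement is placed at [r.1], the first column that [r] leaves open, and each half is
   visible in only one of [A] and [B]. *)
pose vA c := if c == a then Some true else None.
pose vB c := if c == b then Some false else None.
pose rA' := extend r LA vA; pose rB' := extend r LB vB.
have rA'A : ale rA' (restr r LA).
  by apply: (@ale_extend _ _ _ _ a) => c /negbTE; rewrite /vA => ->.
have rB'B : ale rB' (restr r LB).
  by apply: (@ale_extend _ _ _ _ b) => c /negbTE; rewrite /vB => ->.
have [c1 c1A c1r] : exists2 c, cond_over A c & Phi rA' c.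
  by apply: A1 => x /supp_extend[].
have [cX cXP] := cond_cut c1 (fun t => X (inr t)).
pose LX c := X (inl c).
(* The trace of [c1] on [X] is forced by visible information in [X]; [c1] itself witnesses
   compatibility. *)
have [y [yX yr yc]] : exists y, [/\ over X y, ale y (restr rA' LX) & Phi y `<=` below cX].
  apply: X3.
  - by move=> c /supp_restr[].
  - by move=> t; case e : (sval cX t) => [u|//] _; case/cXP: e.
  - exists c1; split; first exact: Phi_ale (ale_restr _ _) _ c1r.
    by move=> t u /cXP[].
(* As [a] is not in [B] and [b] is not in [A], the halves [rA'] and [rB'] look alike from [X], so
   [y] is compatible with [rB'] too. *)
have [z [zy zr zB]] : exists z, [/\ ale z y, ale z rB' & over B z].
  apply: (@restr_compatible _ _ _ LX) => //.
  - apply: ale_trans yr _; apply: ale_restr_extend.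
    + by move=> c [].
    + by move=> c [].
    + move=> c [Ac Bc]; rewrite /vA /vB; case: eqP => [e|_]; first by rewrite e in Bc.
      by case: eqP => // e; rewrite e in Ac.
  - by move=> c /yX[].
  - by move=> c /supp_extend[].
have [c2 c2B c2z] := B1 z zB.
have c2c1 := yc c2 (Phi_ale zy c2z).
(* Coordinates common to [c1] and [c2] lie in [X], where [c2] extends the trace of [c1]. *)
have [d [d1 d2 dP]] : exists e : Cond T, [/\ cle e c1, cle e c2 &
    forall t u, sval e t = Some u -> sval c1 t = Some u \/ sval c2 t = Some u].
  apply: cond_union => t u v t1 t2.
  have : sval cX t = Some u.
    apply/cXP; split=> //; split; first by apply: c1A; rewrite t1.
    by apply: c2B; rewrite t2.
  by move/c2c1; rewrite t2 => -[].
have c1p : cle c1 pA by apply: rA; exact: Phi_ale rA'A _ c1r.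
have c2p : cle c2 pB by apply: rB; apply: Phi_ale rB'B _ _; exact: Phi_ale zr _ c2z.
(* Each coordinate of [d] lies in [A] or [B], and there [c1] or [c2] extends the corresponding part
   of [p]. *)
have [e [ed ep _]] : exists e : Cond T, [/\ cle e d, cle e p &
    forall t u, sval e t = Some u -> sval d t = Some u \/ sval p t = Some u].
  apply: cond_union => t u v /dP[] tu tp.
    have /pAP/c1p : A (inr t) /\ sval p t = Some v by split=> //; apply: c1A; rewrite tu.
    by rewrite tu => -[].
  have /pBP/c2p : B (inr t) /\ sval p t = Some v by split=> //; apply: c2B; rewrite tu.
  by rewrite tu => -[].
have eA : Phi rA' e by apply: Phi_cle c1r (cle_trans ed d1).
have eB : Phi rB' e by apply: Phi_cle (Phi_ale zr c2z) (cle_trans ed d2).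
have [s [sA sB se]] := Phi_meet eA eB.
have [f sf] := Phi_neq0 s.
(* Below [e] all of [rA'], [rB'] and [r0] are forced, so some [g] extends them all and shows both
   [true] and [false] at [r.1] against the coherence over [r0]. *)
have fr0 : Phi r0 f by apply: Phi_cle r0p (cle_trans (se _ sf) ep).
have [g [gs gr0 _]] := Phi_meet sf fr0.
have [nA _ vgA _] := ale_trans gs sA; have [_ _ vgB _] := ale_trans gs sB.
have [_ _ _ coh] := gr0.
suff : true = false by [].
apply: (coh a b r.1).
- by rewrite supp_tabulate inE eqxx.
- by rewrite supp_tabulate !inE eqxx orbT.
- by rewrite /=; exact: nA.
- by rewrite vgA ?value_extend ?ltnn /vA ?eqxx//; apply/supp_extend.
- by rewrite vgB ?value_extend ?ltnn /vB ?eqxx//; apply/supp_extend.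
Qed.

End NotCohen.

(** * Uniform density *)

(** Every other added cell is left undefined, so coherence cannot fail. *)
Lemma ale_prescribe {L : eqType} (q : acond L) a n v :
  a \notin supp q \/ q.1 <= n ->
  exists q', [/\ ale q' q, a \in supp q', n < q'.1 & value q' a n = v].
Proof.
move=> h; pose g c k := if (c \in supp q) && (k < q.1) then value q c k
  else if (c == a) && (k == n) then v else None.
exists (tabulate (maxn q.1 n.+1) (a :: supp q) g); split.
- apply: ale_tabulate; first exact: leq_maxl.
  + by move=> c cq; rewrite inE cq orbT.
  + by move=> c k cq kq; rewrite /g cq kq.
  + move=> c d k u w _ _ /andP[k1 _]; rewrite /g ltnNge k1 !andbF /=.
    case: ifP => // /andP[_ _] eu; case: ifP => // _; by rewrite eu => -[].
- by rewrite supp_tabulate inE eqxx.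
- by rewrite /= leq_max ltnSn orbT.
- rewrite value_tabulate ?inE ?eqxx// ?leq_max ?ltnSn ?orbT// /g !eqxx /=.
  by case: h => [/negbTE ->//|]; rewrite leqNgt => /negbTE ->; rewrite andbF.
Qed.

Section Main.
Context {L : eqType} {T : Type} (vis : Cond T -> acond L -> Prop).
Hypothesis visP : projection ale vis.
Hypothesis hL : card_is_aleph2 [set: L].

Let A := invariant_sets vis.
Let N := basic ale vis.

(** Choose a basic set below each member of [D]. Some row [a] is mentioned by none of them, so none
    decides f_a at a given position, whereas a basic set below [b] can prescribe that value. *)
Lemma dense_not_le_aleph1 b D : A b -> b <> set0 -> dense_below A b D ->
  ~ card_le_aleph1 D.
Proof.
move=> Ab b0 [DA Dd] lD.
have [g gP] : {g : set (Cond T) -> acond L & forall d, D d -> N (g d) `<=` d}.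
  apply: (choice (P := fun d q => D d -> N q `<=` d)) => d.
  have [Dd'|nD] := pselect (D d); last by exists (0, [::]).
  have [Ad [d0 _]] := DA d Dd'; have [q qd] := basic_dense visP Ad d0.
  by exists q.
have cM d : countable [set a | a \in supp (g d)].
  by apply: finite_set_countable; exact: finite_seq.
have [a na] : exists a, ~ (\bigcup_(d in D) [set a | a \in supp (g d)]) a.
  apply: contrapT => nex; have [nL _] := hL; apply: nL.
  apply: le_aleph1_sub (le_aleph1_bigcup lD cM) => a _.
  by apply: contrapT => na; apply: nex; exists a.
have [q qb] := basic_dense visP Ab b0.
have [q' [q'q aq' nq' vq']] := ale_prescribe (a := a) (Some true) (or_intror (leqnn q.1)).
have [d Dd' dq'] := Dd (N q') (basic_invariant visP q') (basic_neq0 visP (q := q'))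
  (subset_trans (basic_le visP q'q) qb).
have agd : a \notin supp (g d) by apply/negP => agd; apply: na; exists d.
(* As [a] is new to [g d], its value at [q.1] may be fixed as undefined, even below the length of
   [g d]. *)
have [r [rg ar nr vr]] := ale_prescribe (n := q.1) None (or_introl agd).
have /eqP/set0P[p pr] := basic_neq0 visP (q := r).
have pq' : N q' p by apply: dq'; apply: (gP d Dd'); exact: basic_le rg _ pr.
have [z [_ _ vz _] [_ _ vz' _]] := basic_compatible visP pr pq'.
by have := vz a q.1 ar nr; rewrite vr vz'// vq'.
Qed.

Lemma invariant_uniform_density : uniform_density_aleph2 A.
Proof.
move=> b Ab b0; split; last by move=> D; exact: dense_not_le_aleph1.
(* Restricting supports to [Y] makes the family of basic sets below [b] finitary in [Y], with
   countable values at countable sets. *)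
pose F (Y : set L) := [set d | exists2 q, in_supp q Y & d = N q /\ N q `<=` b].
have FD : dense_below A b (F setT).
  split; first by move=> d [q _ [-> qb]]; split; [exact: basic_invariant|split=> //; exact: basic_neq0].
  move=> c Ac c0 cb; have [q qc] := basic_dense visP Ac c0.
  by exists (N q) => //; exists q => //; split=> //; exact: subset_trans cb.
exists (F setT); split=> //; split; first exact: dense_not_le_aleph1 FD.
have [_ [lt [wL segL]]] := hL.
apply: finitary_wellorder_aleph2 wL segL.
  split=> [C D CD d [q qC qd]|C d [q qC qd]]; first by exists q => // a /qC/CD.
  exists (supp q); split; last by exists q => // a aq; exact: In_mem.
  move=> x xq; apply: qC; elim: (supp q) xq => //= y s IH [->|/IH]; rewrite inE ?eqxx// => ->.
  by rewrite orbT.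
move=> C cC; apply: (countable_surj (f := N) (countable_in_supp cC)).
by move=> d [q qC [-> _]]; exists q.
Qed.

Lemma invariant_not_cohen : ~ ba_isomorphic A (@RO T).
Proof.
move=> [f [[ffun _ fsurj] fle]].
have NA q : A (N q) by exact: basic_invariant.
have A0 : A set0 by split; [exact: regular_open0|].
have fN q : regular_open (f (N q)) by exact: ffun.
have f0 : f set0 = set0.
  have [a Aa fa] := fsurj set0 regular_open0.
  by apply/seteqP; split=> //; rewrite -[X in _ `<=` X]fa; apply/(fle _ _ A0 Aa).
apply: (@not_cohen L T (f \o N) _ _ _ _ hL).
- by move=> q c c' /= qc c'c; exact: regular_open_cle qc.
- move=> q; apply/set0P/eqP => /= e; apply: (@basic_neq0 _ _ _ _ visP q).
  by apply/seteqP; split=> //; apply/(fle _ _ (NA q) A0); rewrite e f0.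
- by move=> q q' q'q; apply/(fle _ _ (NA q') (NA q)); exact: basic_le.
move=> q q' c /= qc q'c; have [a Aa fa] := fsurj (below c) (@regular_open_below _ c).
have [q1 q1a] : exists q1, N q1 `<=` a.
  apply: (basic_dense visP Aa) => a0; have : below c c by [].
  by rewrite -fa a0 f0.
have fq1 : f (N q1) `<=` below c by rewrite -fa; apply/(fle _ _ (NA q1) Aa).
have q1q : N q1 `<=` N q.
  apply/(fle _ _ (NA q1) (NA q)) => d /fq1 dc; exact: regular_open_cle dc qc.
have q1q' : N q1 `<=` N q'.
  apply/(fle _ _ (NA q1) (NA q')) => d /fq1 dc; exact: regular_open_cle dc q'c.
(* Inclusion of basic sets need not come from [ale], so common extensions are taken twice, first
   with [q] and then with [q']. *)
have /eqP/set0P[p pq1] := basic_neq0 visP (q := q1).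
have [z1 z1q1 z1q] := basic_compatible visP pq1 (q1q _ pq1).
have /eqP/set0P[p' pz1] := basic_neq0 visP (q := z1).
have [z zz1 zq'] := basic_compatible visP pz1 (q1q' _ (basic_le visP z1q1 pz1)).
exists z; split=> //; first exact: ale_trans zz1 z1q.
apply: subset_trans fq1; apply/(fle _ _ (NA z) (NA q1)); apply: (basic_le visP).
exact: ale_trans zz1 z1q1.
Qed.

End Main.

Theorem theorem2 (T : Type) (hT : card_is_aleph2 [set: T]) :
  exists A : set (set (Cond T)),
    complete_subalgebra A /\ uniform_density_aleph2 A /\ ~ ba_isomorphic A (@RO T).
Proof.
(* Each row needs countably many Cohen coordinates, hence a copy of L x nat inside [T]. *)
have [L [hL [i iinj]]] := aleph2_times_nat hT.
have [l0 _] : [set: L] !=set0.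
  apply/set0P/eqP => e; have [nL _] := hL; apply: nL; rewrite e.
  exact: countable_le_aleph1 (countable0 _).
have [code code_inj] := coord_injection l0 iinj.
have visP := vis_projection code_inj.
exists (invariant_sets (vis code)); split; first exact: invariant_complete visP.
split; first exact: invariant_uniform_density visP hL.
exact: invariant_not_cohen visP hL.
Qed.
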